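(* Let $F/\mathbb{F}_q$, $n$, $g$, $Q$, $D_1$, $D_2$, $\mathcal{P}=\{P_1,\dots,P_N\}$, the maps $E_1,E_2,T,\Lambda,I_1,I_2$, and the decomposition $\mathcal{L}(D_1+D_2)=\mathcal{L}(D_1)\oplus\mathcal{L}_r(D_2)\oplus\mathcal{M}$ with $\mathcal{M}\subseteq\ker\Lambda$ be as described in the context. Let $P_{\mathcal{M}^s}$ be the projection of $\mathcal{L}(D_1+D_2)$ onto $\mathcal{M}^s=\mathcal{L}(D_1)\oplus\mathcal{L}_r(D_2)$ (along $\mathcal{M}$). Then for any elements $x,y\in\mathbb{F}_{q^n}$, the product of $x$ by $y$ satisfies $$xy=\Lambda\circ P_{\mathcal{M}^s}\Bigl(T^{-1}_{|\operatorname{Im}T}\bigl(T\circ I_1\circ E_1^{-1}(x)\odot T\circ I_2\circ E_2^{-1}(y)\bigr)\Bigr),$$ where $T^{-1}_{|\operatorname{Im}T}:\operatorname{Im}T\to\mathcal{L}(D_1+D_2)$ is the inverse of $T$ on its image and $\odot$ is the componentwise product.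
   Context: Let $q$ be a prime power and $F/\mathbb{F}_q$ an algebraic function field of one variable with full constant field $\mathbb{F}_q$ and genus $g$, given as a finite extension of a rational function field $\mathbb{F}_q(x)$. For a divisor $D$, $\mathcal{L}(D)=\{f\in F^\times:(f)+D\ge 0\}\cup\{0\}$ is its Riemann-Roch space. For a place $P$, $F_P$ is its residue class field, isomorphic to $\mathbb{F}_{q^{\deg P}}$, and for $f$ in the valuation ring of $P$, $f(P)\in F_P$ denotes the residue class of $f$. Choice of places. Let $n\ge 1$. Let $\mathcal{Q}(x)\in\mathbb{F}_q[x]$ be an irreducible polynomial of degree $n$ which is primitive (a root generates $\mathbb{F}_{q^n}^\times$) and whose place in $\mathbb{F}_q(x)$ splits completely in $F$. Let $Q$ be a place of $F$ of degree $n$ lying above $\mathcal{Q}(x)$. Let $D_1\neq D_2$ be two places of $F$ of degree $n+g-1$ (also regarded as effective divisors) such that for $i=1,2$ the divisor $D_i-Q$ is non-special of degree $g-1$, i.e. $\dim\mathcal{L}(D_i-Q)=0$. Let $\mathcal{P}=\{P_1,\dots,P_N\}$ be a set of $N$ distinct places of $F$, of arbitrary degrees, containing none of $Q,D_1,D_2$. Maps. Identify $\mathbb{F}_{q^n}$ with $F_Q$, with basis $\mathcal{B}_Q=(1,\alpha,\dots,\alpha^{n-1})$, $\alpha$ being a root of $\mathcal{Q}(x)$. - $E_i:\mathcal{L}(D_i)\to F_Q$, $f\mapsto f(Q)$, for $i=1,2$; since $\deg Q=n$, $\deg D_i=n+g-1$ and $\ker E_i=\mathcal{L}(D_i-Q)=\{0\}$,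 these are $\mathbb{F}_q$-linear isomorphisms. The basis of $\mathcal{L}(D_i)$ is $(f_{i,1},\dots,f_{i,n})=E_i^{-1}(\mathcal{B}_Q)$, with $f_{i,1}=1$. - $T:\mathcal{L}(D_1+D_2)\to\mathbb{F}_{q^{\deg P_1}}\times\cdots\times\mathbb{F}_{q^{\deg P_N}}$, $f\mapsto(f(P_1),\dots,f(P_N))$, is assumed to be injective. - $\Lambda:\mathcal{L}(D_1+D_2)\to F_Q$, $f\mapsto f(Q)$. - $I_i:\mathcal{L}(D_i)\to\mathcal{L}(D_1+D_2)$, $i=1,2$, are the inclusions (well defined since $D_1,D_2$ are effective). - $\odot$ is the Hadamard product $(u_1,\dots,u_N)\odot(v_1,\dots,v_N)=(u_1v_1,\dots,u_Nv_N)$ on $\mathbb{F}_{q^{\deg P_1}}\times\cdots\times\mathbb{F}_{q^{\deg P_N}}$. Decomposition. $\mathcal{L}_r(D_2)$ is the span of $f_{2,2},\dots,f_{2,n}$, so that $\mathcal{L}(D_2)=\mathbb{F}_q\oplus\mathcal{L}_r(D_2)$, and $\mathcal{M}\subseteq\ker\Lambda$ is a subspace of dimension $g$ with $\mathcal{L}(D_1+D_2)=\mathcal{L}(D_1)\oplus\mathcal{L}_r(D_2)\oplus\mathcal{M}$. In the basis $(f_{1,1},\dots,f_{1,n},f_{2,2},\dots,f_{2,n})$ followed by a basis of $\mathcal{M}$, for $x=\sum_k x_k\alpha^{k-1}$ and $y=\sum_k y_k\alpha^{k-1}$ with $x_k,y_k\in\mathbb{F}_q$, one has $I_1(E_1^{-1}(x))=(x_1,\dots,x_n,0,\dots,0)$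 and $I_2(E_2^{-1}(y))=(y_1,0,\dots,0,y_2,\dots,y_n,0,\dots,0)$. *)

(* Defs.v *)
From HB Require Import structures.
From mathcomp Require Import all_boot all_order all_algebra all_field.
From mathcomp Require Import generic_quotient ring_quotient.
From mathcomp.multinomials Require Import freeg.
From mathcomp Require Import boolp classical_sets functions.

Set Implicit Arguments.
Unset Strict Implicit.
Unset Printing Implicit Defensive.

Import Order.TTheory GRing.Theory Num.Theory.

Local Open Scope ring_scope.
Local Open Scope classical_set_scope.
Local Open Scope quotient_scope.

(* A function field F over k is a finite extension of the field k(x) of       *)
(* fractions of {poly k}.                                                     *)
Section Constants.
Variables (k : finFieldType) (F : fieldExtType {fraction {poly k}}).

Definition polyF (p : {poly k}) : F := (tofrac p)%:A.

Definition constF (c : k) : F := polyF c%:P.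

Definition full_constant_field : Prop :=
  forall z : F, algebraicOver constF z -> exists c : k, z = constF c.

End Constants.
Arguments constF {k F} c.
Arguments polyF {k F} p.

Section Spans.
Variables (k : finFieldType) (A : nzRingType) (iota : k -> A).

Definition kspan m (e : 'I_m -> A) : set A :=
  [set v | exists c : 'I_m -> k, v = \sum_i iota (c i) * e i].

Definition has_dim (V : set A) (m : nat) : Prop :=
  exists e : 'I_m -> A,
    V = kspan e /\
    forall c : 'I_m -> k, \sum_i iota (c i) * e i = 0 -> forall i, c i = 0.

(* The value 0 is also taken by infinite-dimensional spaces, but residue      *)
(* fields and Riemann-Roch spaces, to which this is applied, are finite       *)
(* dimensional.                                                               *)
Definition kdim (V : set A) : nat := xget 0%N [set m | has_dim V m].

End Spans.

(* A place is given by its valuation ring: a discrete valuation ring of F     *)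
(* that contains k. Membership is boolean, so that two places are equal as    *)
(* soon as their valuation rings have the same elements.                      *)
Record place (k : finFieldType) (F : fieldExtType {fraction {poly k}}) := Place {
  vring : F -> bool;
  vring_subring : subring_closed vring;
  vring_const : forall c : k, constF c \in vring;
  vring_proper : exists z, z \notin vring;
  vring_val : forall z, (z \in vring) || (z^-1 \in vring);
  vring_discrete : exists t, [/\ t \in vring, t^-1 \notin vring &
    forall z, z != 0 -> exists (m : int) (u : F),
      [/\ u \in vring, u^-1 \in vring & z = t ^ m * u]]
}.

Section Places.
Variables (k : finFieldType) (F : fieldExtType {fraction {poly k}}).

HB.instance Definition _ := gen_eqMixin (place F).
HB.instance Definition _ := gen_choiceMixin (place F).

Section OnePlace.
Variable P : place F.

HB.instance Definition _ :=
  GRing.isSubringClosed.Build F (vring P) (vring_subring P).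

Record valring := ValRing { valring_val : F; _ : valring_val \in vring P }.

HB.instance Definition _ := [isSub for valring_val].
HB.instance Definition _ := [Choice of valring by <:].
HB.instance Definition _ := [SubChoice_isSubComNzRing of valring by <:].

Definition maxideal : {pred F} :=
  [pred z | (z \in vring P) && ((z == 0) || (z^-1 \notin vring P))].

Definition valring_max : {pred valring} := [pred z | val z \in maxideal].

Lemma valring_max_zmod : zmod_closed valring_max.
Proof.
have mulO a b : a \in vring P -> b \in vring P -> a * b \in vring P.
  by move=> aO bO; apply: rpredM.
have key x y : x \in maxideal -> y \in maxideal -> y != 0 ->
    x / y \in vring P -> x - y \in maxideal.
  move=> /andP[xO _] /andP[yO ym] y0 xyO; apply/andP; split; first exact: rpredB.
  rewrite (negPf y0) /= in ym.
  case: eqVneq => //= d0; apply: contra ym => dO.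
  have -> : y^-1 = (x / y - 1) * (x - y)^-1.
    by rewrite -[X in x / y - X](divff y0) -mulrBl mulrAC divff // mul1r.
  by rewrite mulO // rpredB ?rpred1.
have opp x : x \in maxideal -> - x \in maxideal.
  by rewrite !inE rpredN oppr_eq0 invrN rpredN.
split=> [|x y xM yM].
  by rewrite !inE eqxx rpred0.
change (val x - val y \in maxideal).
have {}xM : val x \in maxideal by [].
have {}yM : val y \in maxideal by [].
have [->|x0] := eqVneq (val x) 0; first by rewrite sub0r opp.
have [->|y0] := eqVneq (val y) 0; first by rewrite subr0.
have := vring_val P (val x / val y); case/orP; first exact: key.
rewrite invf_div => yxO.
by rewrite -opprB opp // key.
Qed.

Lemma valring_max_ideal : idealr_closed valring_max.
Proof.
split; first by case: valring_max_zmod.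
  by rewrite !inE /= oner_eq0 invr1 rpred1.
move=> a x y xM yM.
have oppM z : z \in valring_max -> - z \in valring_max.
  by case: valring_max_zmod => z0 zB zM; rewrite -sub0r zB.
rewrite -[y]opprK; apply: valring_max_zmod.2; last exact: oppM.
case/andP: xM => xO xM; rewrite !inE /=.
apply/andP; split; first by apply: rpredM => //; apply: valP.
case/orP: xM => [/eqP ->|xM]; first by rewrite mulr0 eqxx.
case: eqVneq => //= ax0; apply: contra xM => axO.
have a0 : val a != 0 by apply: contraNneq ax0 => ->; rewrite mul0r.
rewrite invfM in axO.
have -> : (val x)^-1 = val a * ((val a)^-1 * (val x)^-1) by rewrite mulVKf.
by apply: rpredM => //; apply: valP.
Qed.

HB.instance Definition _ := isIdealr.Build valring valring_max valring_max_ideal.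

Definition resfield := {ideal_quot valring_max}.

HB.instance Definition _ := GRing.ComNzRing.on resfield.

Definition res_class (z : valring) : resfield := \pi z.

(* f(P); it is 0 by convention when f is not in the valuation ring of P.     *)
Definition evalp (f : F) : resfield := res_class (insubd 0 f).

Definition res_inv (a : resfield) : resfield :=
  if a == 0 then 0 else evalp (val (repr a))^-1.

Lemma res_mulVf (a : resfield) : a != 0 -> res_inv a * a = 1.
Proof.
move=> a0; rewrite /res_inv (negPf a0).
have e : a = res_class (repr a) by rewrite /res_class reprK.
set z := repr a in e *.
have zN : z \notin valring_max.
  apply: contra a0 => zM; rewrite e.
  have -> : (0 : resfield) = res_class 0 by rewrite /res_class rmorph0.
  by rewrite /res_class -Quotient.idealrBE subr0.
have : val z \in vring P by apply: valP.
move: zN; rewrite !inE => /[swap] zO; rewrite zO /= negb_or negbK.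
case/andP=> z0 zVO.
rewrite e /evalp /res_class -[RHS](rmorph1 (\pi_resfield)) -rmorphM.
congr (\pi _); apply: val_inj; rewrite /= insubdK //.
by rewrite mulVf.
Qed.

Lemma res_inv0 : res_inv 0 = 0.
Proof. by rewrite /res_inv eqxx. Qed.

HB.instance Definition _ :=
  GRing.ComNzRing_isField.Build resfield res_mulVf res_inv0.

Definition res_const (c : k) : resfield := evalp (constF c).

Definition pdeg : nat := kdim res_const [set: resfield].

Definition uniformizer (t : F) : Prop :=
  [/\ t != 0, t \in maxideal & forall z, z \in maxideal -> z / t \in vring P].

(* Only meaningful for f != 0. *)
Definition ordp (f : F) : int :=
  xget 0 [set m : int | exists t u : F,
    [/\ uniformizer t, u \in vring P, u^-1 \in vring P & f = t ^ m * u]].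

(* P lies above the place of k(x) attached to the irreducible polynomial p,   *)
(* whose maximal ideal consists of the a / b with p | a and p not dividing b. *)
Definition lies_above (p : {poly k}) : Prop :=
  forall a b : {poly k}, p %| a -> ~~ (p %| b) ->
    polyF a / polyF b \in maxideal.

End OnePlace.

Definition splits_completely (p : {poly k}) : Prop :=
  exists s : seq (place F),
    [/\ uniq s, size s = \dim {:F} & forall P, P \in s <-> lies_above P p].

Definition divisor := {freeg place F}.

Definition degree (D : divisor) : int :=
  \sum_(P <- dom D) coeff P D * (pdeg P)%:Z.

Definition RRspace (D : divisor) : set F :=
  [set f | f = 0 \/ forall P, 0 <= ordp P f + coeff P D].

Definition ell (D : divisor) : nat := kdim constF (RRspace D).

Definition is_genus (g : int) : Prop :=
  (exists D, degree D - (ell D)%:Z + 1 = g) /\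
  (forall D, degree D - (ell D)%:Z + 1 <= g).

End Places.

(* Primitivity of p, not assumed monic: the extension L of k of degree deg p  *)
(* contains a root of p that generates its multiplicative group.              *)
Definition has_primitive_root (k : finFieldType) (p : {poly k}) : Prop :=
  exists (L : fieldExtType k) (z : L),
    [/\ \dim {:L} = (size p).-1, root (map_poly (in_alg L) p) z, z != 0 &
        forall u : L, u != 0 -> exists i : nat, u = z ^+ i].

Section LinearMaps.
Variable F : fieldType.

Definition setadd (A B : set F) : set F := [set a + b | a in A & b in B].

Definition independent (A B : set F) : Prop := A `&` B = [set 0].

Definition proj_along (A B : set F) (h : F) : F :=
  xget 0 [set a | A a /\ B (h - a)].

Definition inv_on (T : Type) (A : set F) (f : F -> T) : T -> F :=
  'pinv_(fun=> 0) A f.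

End LinearMaps.

Section MultiplicationMaps.
Variables (k : finFieldType) (F : fieldExtType {fraction {poly k}}).

(* Riemann-Roch spaces are subsets of F, so that the inclusion of L(D_i) in   *)
(* L(D1 + D2) is the identity, and f |-> f(Q) on L(D) is evalp Q.             *)
Definition Einv (Q D : place F) : resfield Q -> F :=
  inv_on (RRspace << D >>) (evalp Q).

(* The span of the inverse images of alpha, ..., alpha ^+ (n - 1).            *)
Definition RRrest (Q D : place F) (n : nat) (alpha : resfield Q) : set F :=
  kspan constF (fun i : 'I_n.-1 => Einv D (alpha ^+ i.+1)).

Definition evals (N : nat) (P : 'I_N -> place F) (f : F) :
    forall i, resfield (P i) :=
  fun i => evalp (P i) f.

Definition hadamard (N : nat) (P : 'I_N -> place F)
    (u v : forall i, resfield (P i)) : forall i, resfield (P i) :=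
  fun i => u i * v i.

End MultiplicationMaps.

(* Main.v *)
Require Import Defs.
From HB Require Import structures.
From mathcomp Require Import all_boot all_order all_algebra all_field.
From mathcomp Require Import generic_quotient ring_quotient.
From mathcomp.multinomials Require Import freeg.
From mathcomp Require Import boolp classical_sets functions.
From mathcomp Require Import zify.

Set Implicit Arguments.
Unset Strict Implicit.
Unset Printing Implicit Defensive.

Import Order.TTheory GRing.Theory Num.Theory.

Local Open Scope ring_scope.
Local Open Scope classical_set_scope.

(** Write [h] for the product in [F] of [f1], the preimage of [x] under
    [f |-> f(Q)] in L(D1), and [f2], the preimage of [y] in L(D2). It lies in
    L(D1 + D2). As no [P i] is a pole of [f1] or [f2], evaluation at [P i] is
    multiplicative on them, so the Hadamard product of their evaluations is
    [T h], and injectivity of [T] on L(D1 + D2) gives back [h]. The projection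
    along [M] changes [h] by an element of [M], which vanishes at [Q]; hence
    the value at [Q] of the result is [h(Q) = x * y].

    The substance is that the preimages exist, i.e. that evaluation at [Q] maps
    L(D) onto the residue field ([eval_onto]). Its kernel is L(D - Q), which
    is zero, and the maximality in the definition of the genus gives
    dim L(D) >= deg D + 1 - g = n, while the residue field has dimension [n].
    Over a finite field an injective map between spaces of such dimensions is
    onto by counting ([injective_onto]).

    One subtlety: [kdim] is 0 on infinite-dimensional spaces, so
    [ell (D - Q) = 0] forces L(D - Q) = 0 only once L(D - Q) is known to be
    finite dimensional. It is, as a subspace of L(D) ([has_dim_sub]), and L(D)
    is finite dimensional because its [kdim] is at least [n > 0].

    The algebra of Riemann-Roch spaces (stability under linear combinations,
    products) rests on [RRspaceP], which replaces the conditions on orders by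
    membership of [f * t ^ coeff P D] in the valuation rings. *)

(** * Finite-dimensional spaces over a finite field *)

Section Dimension.
Variable k : finFieldType.

Lemma kdim_gt0P (A : nzRingType) (iota : k -> A) (V : set A) m :
  kdim iota V = m -> (0 < m)%N -> has_dim iota V m.
Proof.
rewrite /kdim; case: xgetP => [d _ hd <- //|_ <-].
by rewrite ltnn.
Qed.

Lemma kdim_eq0P (A : nzRingType) (iota : k -> A) (V : set A) m :
  has_dim iota V m -> kdim iota V = 0%N -> V `<=` [set 0].
Proof.
move=> hm d0; have : has_dim iota V (kdim iota V).
  by apply: (xgetPex 0%N); exists m.
by rewrite d0 => -[e [-> _]] v [c ->]; rewrite big_ord0.
Qed.

(** The coordinate vectors of the elements of [V] span a subspace of ['rV_m];
    the combinations given by a basis of it form a basis of [V]. *)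
Lemma has_dim_sub (A : nzRingType) (iota : {rmorphism k -> A})
    (V W : set A) m :
  V 0 -> (forall c u v, V u -> V v -> V (iota c * u + v)) ->
  V `<=` W -> has_dim iota W m -> exists d, has_dim iota V d.
Proof.
move=> V0 Vlin VW [e [We e_free]].
pose comb (v : 'rV[k]_m) := \sum_j iota (v 0 j) * e j.
have combE r (c : 'I_r -> k) v :
    comb (\sum_i c i *: v i) = \sum_i iota (c i) * comb (v i).
  under [RHS]eq_bigr do rewrite mulr_sumr.
  rewrite exchange_big /=; apply: eq_bigr => j _.
  rewrite summxE rmorph_sum mulr_suml; apply: eq_bigr => i _.
  by rewrite mxE rmorphM mulrA.
have Vsum r (c : 'I_r -> k) u : (forall i, V (u i)) ->
    V (\sum_i iota (c i) * u i).
  by move=> Vu; elim/big_rec: _ => // i v _ Vv; apply: Vlin.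
pose X := [seq v <- enum {: 'rV[k]_m} | `[< V (comb v) >]].
pose U := <<X>>%VS.
have UV v : v \in U -> V (comb v).
  rewrite -[U]/<<in_tuple X>>%VS => /coord_span ->.
  rewrite combE; apply: Vsum => i; apply/asboolP.
  by have /(mem_nth 0) : (i < size X)%N by []; rewrite mem_filter => /andP[].
exists (\dim U), (fun i => comb (vbasis U)`_i); split.
  rewrite eqEsubset; split=> [v Vv|_ [c ->]]; last first.
    by apply: Vsum => i; apply/UV/vbasis_mem/mem_nth; rewrite size_tuple.
  have := VW _ Vv; rewrite We => -[c vE].
  have rE : comb (\row_i c i) = v.
    by rewrite vE; apply: eq_bigr => i _; rewrite mxE.
  have rU : \row_i c i \in U.
    by apply: memv_span; rewrite mem_filter mem_enum andbT rE; apply/asboolP.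
  by rewrite -rE (coord_vbasis rU) combE; eexists.
move=> c; rewrite -combE => /e_free c0.
apply: (freeP (basis_free (vbasisP U))).
by apply/rowP => j; rewrite c0 mxE.
Qed.

(** Counting: passing to coordinates, [f] becomes an injection of [k ^ m] into
    [k ^ n], which is a bijection as [n <= m]. *)
Lemma injective_onto (A B : nzRingType) (iA : {rmorphism k -> A}) (iB : k -> B)
    (V : set A) (f : A -> B) m n :
  has_dim iA V m -> has_dim iB [set: B] n -> (n <= m)%N ->
  {in V &, injective f} -> forall x, exists2 v, V v & f v = x.
Proof.
move=> [a [Va a_free]] [b [Bb _]] nm f_inj x.
have coord y : {c : {ffun 'I_n -> k} | y = \sum_i iB (c i) * b i}.
  apply: cid; have : [set: B] y by [].
  rewrite Bb => -[c ->]; exists (finfun c).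
  by apply: eq_bigr => i _; rewrite ffunE.
pose s (c : {ffun 'I_m -> k}) := \sum_i iA (c i) * a i.
have Vs c : V (s c) by rewrite Va; exists c.
have s_inj : injective s.
  move=> c d /eqP; rewrite -subr_eq0 -sumrB => /eqP sE.
  apply/ffunP => i; apply/eqP; rewrite -subr_eq0; apply/eqP.
  apply: (a_free (fun i => c i - d i)); rewrite -[RHS]sE.
  by apply: eq_bigr => j _; rewrite rmorphB mulrBl.
pose phi c := sval (coord (f (s c))).
have phi_inj : injective phi.
  move=> c d phiE; apply/s_inj/f_inj; rewrite ?inE //.
  rewrite (svalP (coord (f (s c)))) (svalP (coord (f (s d)))).
  by rewrite -[sval _]/(phi c) phiE.
have [psi _ phiK] : bijective phi.
  apply: inj_card_bij => //; rewrite !card_ffun !card_ord.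
  by rewrite leq_pexp2l //; apply/card_gt0P; exists 0.
exists (s (psi (sval (coord x)))) => //.
have /= cE := phiK (sval (coord x)); set c := psi _ in cE *.
by rewrite [LHS](svalP (coord (f (s c)))) [RHS](svalP (coord x)) -cE.
Qed.

End Dimension.

(** * Valuations and residue classes *)

Section Valuations.
Variables (k : finFieldType) (F : fieldExtType {fraction {poly k}}).

HB.instance Definition _ := GRing.RMorphism.copy (@constF k F)
  (in_alg F \o (@tofrac _) \o polyC)%FUN.

Section OnePlace.
Local Open Scope quotient_scope.
Variable P : place F.
Implicit Types (f u t z : F) (m : int).

Definition vunit u := (u \in vring P) && (u^-1 \in vring P).

Lemma vunitM u v : vunit u -> vunit v -> vunit (u * v).
Proof. by case/andP=> ? ? /andP[? ?]; rewrite /vunit invfM !rpredM. Qed.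

Lemma vunitV u : vunit u -> vunit u^-1.
Proof. by rewrite /vunit invrK andbC. Qed.

Lemma vunit_exp u m : vunit u -> vunit (u ^ m).
Proof.
move=> uU; have uX n : vunit (u ^+ n).
  by case/andP: uU => uO uV; rewrite /vunit -exprVn !rpredX.
by case: m => n; [apply: uX | apply/vunitV/uX].
Qed.

Lemma vring_mul_unit f u : u != 0 -> vunit u ->
  (f * u \in vring P) = (f \in vring P).
Proof.
move=> u0 /andP[uO uV]; apply/idP/idP => [fuO|fO]; last exact: rpredM.
by rewrite -(mulfK u0 f) rpredM.
Qed.

Lemma vring_not_inv t : t \in maxideal P -> t != 0 -> t^-1 \notin vring P.
Proof. by rewrite !inE => /andP[_ /orP[->|]]. Qed.

Lemma uniformizer_exp t m : uniformizer P t -> (t ^ m \in vring P) = (0 <= m).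
Proof.
case=> t0 tM _; have [tO tV] : t \in vring P /\ t^-1 \notin vring P.
  by move: tM; rewrite !inE (negPf t0) => /andP[].
case: m => n /=; first by rewrite rpredX.
apply/negbTE; apply: contra tV => tnO.
suff -> : t^-1 = t ^+ n * t ^- n.+1 by rewrite rpredM ?rpredX.
by rewrite exprS invfM mulrC -mulrA mulVf ?mulr1 ?expf_neq0.
Qed.

Lemma uniformizer_factor : exists2 t, uniformizer P t &
  forall f, f != 0 -> exists m u, vunit u /\ f = t ^ m * u.
Proof.
have [t [tO tV fact]] := vring_discrete P.
have t0 : t != 0 by apply: contraNneq tV => ->; rewrite invr0 rpred0.
exists t; last first.
  by move=> f /fact [m [u [uO uV ->]]]; exists m, u; rewrite /vunit uO uV.
split=> // [|z]; first by rewrite !inE tO tV orbT.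
have [->|z0] := eqVneq z 0; first by rewrite mul0r rpred0.
rewrite !inE (negPf z0) /= => /andP[_].
have [[[|n]|n] [u [uO uV zE]]] := fact z z0; rewrite {}zE.
- by rewrite expr0z mul1r uV.
- by rewrite -exprnP exprSr mulrAC mulfK // rpredM ?rpredX.
- by rewrite -[t ^ Negz n]/(t ^- n.+1) invfM invrK rpredM ?rpredX.
Qed.

(** Since [ordp] picks a representation [t' ^ o * u] with an arbitrary
    uniformizer [t'], the point is that [t' / t] is a unit, so that the choice
    does not matter. *)
Lemma le_ordp t f m : uniformizer P t -> f != 0 ->
  (m <= ordp P f) = (f * t ^ (- m) \in vring P).
Proof.
move=> tU f0; have [t0 tM tdiv] := tU.
(* ordp is given by a choice: its defining set is first shown nonempty. *)
have : exists m', [set m : int | exists t u, [/\ uniformizer P t,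
    u \in vring P, u^-1 \in vring P & f = t ^ m * u]] m'.
  have [t' t'U /(_ f f0) [m' [u [/andP[uO uV] fE]]]] := uniformizer_factor.
  by exists m', t', u.
move/(xgetPex (0 : int)); rewrite -/(ordp P f).
case=> t' [u [t'U uO uV]]; set o := ordp P f => fE.
have [t'0 t'M t'div] := t'U.
have u0 : u != 0 by apply: contraNneq f0 => u0; rewrite fE u0 mulr0.
have w0 : t' / t != 0 by rewrite mulf_neq0 ?invr_eq0.
have wU : vunit (t' / t) by rewrite /vunit invf_div tdiv // t'div.
have -> : f * t ^ (- m) = t ^ (o - m) * ((t' / t) ^ o * u).
  rewrite fE -[in LHS](divfK t0 t') expfzMl expfzDr //.
  by rewrite mulrC [_ * t ^ o]mulrC !mulrA [t ^ o * t ^ _]mulrC.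
rewrite vring_mul_unit ?mulf_neq0 ?expfz_neq0 //.
  by rewrite uniformizer_exp // subr_ge0.
by rewrite vunitM ?vunit_exp // /vunit uO.
Qed.

(** This turns vanishing at [P] into a drop of 1 in the order at [P]. *)
Lemma maxideal_divP t z : uniformizer P t ->
  (z \in maxideal P) = (z / t \in vring P).
Proof.
case=> t0 tM tdiv; apply/idP/idP => [/tdiv //|zO].
have tO : t \in vring P by case/andP: tM.
apply/andP; split; first by rewrite -(divfK t0 z) rpredM.
have [//|z0 /=] := eqVneq z 0.
have := vring_not_inv tM t0; apply: contra => zV.
have -> : t^-1 = z^-1 * (z / t) by rewrite mulKf.
by rewrite rpredM.
Qed.

Lemma evalp_class f (fO : f \in vring P) : evalp P f = res_class (ValRing fO).
Proof. by congr res_class; apply: val_inj; rewrite /= insubdK. Qed.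

Lemma evalpB f g : f \in vring P -> g \in vring P ->
  evalp P (f - g) = evalp P f - evalp P g.
Proof.
move=> fO gO; rewrite (evalp_class (rpredB fO gO)) (evalp_class fO).
rewrite (evalp_class gO) /res_class -rmorphB.
by congr (\pi _); apply: val_inj.
Qed.

Lemma evalpM f g : f \in vring P -> g \in vring P ->
  evalp P (f * g) = evalp P f * evalp P g.
Proof.
move=> fO gO; rewrite (evalp_class (rpredM fO gO)) (evalp_class fO).
rewrite (evalp_class gO) /res_class -rmorphM.
by congr (\pi _); apply: val_inj.
Qed.

Lemma evalp_eq0 f : f \in vring P -> evalp P f = 0 -> f \in maxideal P.
Proof.
move=> fO; rewrite (evalp_class fO) /res_class.
rewrite -(rmorph0 (\pi_(resfield P))) => /eqP.
by rewrite -Quotient.idealrBE subr0.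
Qed.

End OnePlace.

(** * Riemann-Roch spaces *)

Implicit Types (D : divisor F) (f g : F).

(** The order being bounded below by [- coeff P D] is a membership in a ring,
    and 0 is no longer an exception; closure properties become those of
    subrings. *)
Lemma RRspaceP D f : RRspace D f <->
  forall P t, uniformizer P t -> f * t ^ coeff P D \in vring P.
Proof.
have [->|f0] := eqVneq f 0.
  by split=> [_ P t _|_]; [rewrite mul0r rpred0|left].
have ordE P t : uniformizer P t ->
    (0 <= ordp P f + coeff P D) = (f * t ^ coeff P D \in vring P).
  by move=> tU; rewrite -lerBlDr sub0r (le_ordp _ tU f0) opprK.
split=> [[/eqP|fD P t tU]|fD]; first by rewrite (negPf f0).
  by rewrite -ordE.
right=> P; have [t tU _] := uniformizer_factor P.
by rewrite (ordE _ t) // fD.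
Qed.

Lemma RRspace0 D : RRspace D 0.
Proof. by left. Qed.

Lemma RRspace_lin D c f g :
  RRspace D f -> RRspace D g -> RRspace D (constF c * f + g).
Proof.
move=> /RRspaceP fD /RRspaceP gD; apply/RRspaceP => P t tU.
by rewrite mulrDl -mulrA rpredD ?gD // rpredM ?fD // vring_const.
Qed.

Lemma RRspaceB D f g : RRspace D f -> RRspace D g -> RRspace D (f - g).
Proof.
move=> /RRspaceP fD /RRspaceP gD; apply/RRspaceP => P t tU.
by rewrite mulrBl rpredB ?fD ?gD.
Qed.

Lemma RRspaceM D E f g :
  RRspace D f -> RRspace E g -> RRspace (D + E) (f * g).
Proof.
move=> /RRspaceP fD /RRspaceP gE; apply/RRspaceP => P t tU.
have [t0 _ _] := tU.
by rewrite coeffD expfzDr // mulrACA rpredM ?fD ?gE.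
Qed.

Lemma RRspace_vring D P f : coeff P D = 0 -> RRspace D f -> f \in vring P.
Proof.
move=> P0 /RRspaceP fD; have [t tU _] := uniformizer_factor P.
by have := fD P t tU; rewrite P0 expr0z mulr1.
Qed.

Lemma coeff_place P Q : coeff P (<< Q >> : divisor F) = (Q == P)%:R.
Proof. by rewrite coeffU mul1r. Qed.

Lemma RRspace_eval0 D Q f : coeff Q D = 0 -> RRspace D f -> evalp Q f = 0 ->
  RRspace (D - << Q >>) f.
Proof.
move=> Q0 fD fQ0; have fM := evalp_eq0 (RRspace_vring Q0 fD) fQ0.
apply/RRspaceP => P t tU; rewrite coeffB coeff_place.
case: eqVneq tU => [<- tU|_ tU]; last by rewrite subr0; apply/RRspaceP: P t tU.
by rewrite Q0 sub0r -(maxideal_divP _ tU).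
Qed.

Lemma RRspace_subplace D Q : RRspace (D - << Q >>) `<=` RRspace D.
Proof.
move=> f /RRspaceP fD; apply/RRspaceP => P t tU.
have [t0 /andP[tO _] _] := tU.
have := fD P t tU; rewrite coeffB coeff_place => fDO.
rewrite -[coeff P D](subrK (Q == P)%:R) expfzDr // mulrA rpredM //.
by case: (Q == P); rewrite ?expr1z ?expr0z ?rpred1.
Qed.

Lemma degree_place (D : place F) : degree << D >> = (pdeg D)%:Z.
Proof. by rewrite /degree domU1 big_seq1 coeff_place eqxx mul1r. Qed.

(** The isomorphism between L(D) and the residue field of [Q]. That [D] differs
    from [Q] also follows: otherwise [D - Q = 0] and L(0) contains 1. *)
Lemma eval_onto (g n : nat) (Q D : place F) :
  is_genus F g%:Z -> (1 <= n)%N -> pdeg Q = n -> pdeg D = (n + g - 1)%N ->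
  ell (<< D >> - << Q >>) = 0%N ->
  D <> Q /\ forall x, exists2 f, RRspace << D >> f & evalp Q f = x.
Proof.
move=> [_ genus_max] n0 Qn Dn ell0.
have ellD : (n <= ell << D >>)%N.
  have := genus_max << D >>; rewrite degree_place Dn; lia.
have LD_dim := kdim_gt0P erefl (leq_trans n0 ellD).
have LDQ0 : RRspace (<< D >> - << Q >>) `<=` [set 0].
  have [d LDQ_dim] : exists d, has_dim constF (RRspace (<< D >> - << Q >>)) d.
    apply: has_dim_sub LD_dim.
    - exact: RRspace0.
    - exact: RRspace_lin.
    - exact: RRspace_subplace.
  exact: kdim_eq0P LDQ_dim ell0.
have DQ : D <> Q.
  move=> DQ; suff /LDQ0/eqP : RRspace (<< D >> - << Q >>) 1 by rewrite oner_eq0.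
  apply/RRspaceP => P t tU; rewrite DQ subrr coeff0 expr0z mulr1.
  exact: rpred1.
split=> // x.
have Q0 : coeff Q (<< D >> : divisor F) = 0.
  by rewrite coeff_place; case: eqP.
apply: (injective_onto LD_dim (kdim_gt0P Qn n0) ellD).
move=> u v; rewrite !inE => uD vD uv; apply/eqP; rewrite -subr_eq0; apply/eqP.
apply/LDQ0/RRspace_eval0 => //; first exact: RRspaceB.
by rewrite evalpB ?uv ?subrr //; apply: RRspace_vring Q0 _.
Qed.

Lemma EinvP (Q D : place F) (x : resfield Q) :
  (forall z, exists2 f, RRspace << D >> f & evalp Q f = z) ->
  RRspace << D >> (Einv D x) /\ evalp Q (Einv D x) = x.
Proof.
move=> onto; have surjE : set_surj (RRspace << D >>) setT (evalp Q).
  by move=> w _; have [f fD <-] := onto w; exists f.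
split; last by apply: (surjpK (fun=> 0) surjE); rewrite inE.
by apply: (surjpinv_image_sub surjE); exists x.
Qed.

End Valuations.

(** * The multiplication formula *)

Theorem theorem3p4 (k : finFieldType) (F : fieldExtType {fraction {poly k}})
    (g n : nat) (Qx : {poly k}) (Q D1 D2 : place F)
    (N : nat) (P : 'I_N -> place F)
    (alpha : resfield Q) (M : set F)
    (hconst : full_constant_field F)
    (hg : is_genus F g%:Z)
    (hn : (1 <= n)%N)
    (hQx_irr : irreducible_poly Qx)
    (hQx_deg : size Qx = n.+1)
    (hQx_prim : has_primitive_root Qx)
    (hQx_split : splits_completely F Qx)
    (hQ_deg : pdeg Q = n)
    (hQ_above : lies_above Q Qx)
    (hD12 : D1 <> D2)
    (hD1_deg : pdeg D1 = (n + g - 1)%N)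
    (hD2_deg : pdeg D2 = (n + g - 1)%N)
    (hD1Q_deg : degree (<< D1 >> - << Q >>) = g%:Z - 1)
    (hD2Q_deg : degree (<< D2 >> - << Q >>) = g%:Z - 1)
    (hD1Q : ell (<< D1 >> - << Q >>) = 0%N)
    (hD2Q : ell (<< D2 >> - << Q >>) = 0%N)
    (hP_inj : injective P)
    (hP : forall i, [/\ P i <> Q, P i <> D1 & P i <> D2])
    (halpha : root (map_poly (@res_const k F Q) Qx) alpha) :
  let LD1 := RRspace << D1 >> in
  let LD12 := RRspace (<< D1 >> + << D2 >>) in
  let Lr2 := RRrest D2 n alpha in
  let Ms := setadd LD1 Lr2 in
  let Lambda := evalp Q in
  let T := evals P in
  let Tinv := inv_on LD12 T in
  let E1inv := Einv (Q := Q) D1 in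
  let E2inv := Einv (Q := Q) D2 in
  let I1 : F -> F := id in
  let I2 : F -> F := id in
  {in LD12 &, injective T} ->
  has_dim constF M g ->
  M `<=` LD12 ->
  (forall f, M f -> Lambda f = 0) ->
  independent LD1 Lr2 ->
  independent Ms M ->
  LD12 = setadd Ms M ->
  forall x y : resfield Q,
    x * y = Lambda (proj_along Ms M
              (Tinv (hadamard (T (I1 (E1inv x))) (T (I2 (E2inv y)))))).
Proof.
move=> LD1 LD12 Lr2 Ms Lambda T Tinv E1inv E2inv I1 I2.
move=> T_inj _ M_sub M_ker _ _ dec x y.
have [D1Q E1_onto] := eval_onto hg hn hQ_deg hD1_deg hD1Q.
have [D2Q E2_onto] := eval_onto hg hn hQ_deg hD2_deg hD2Q.
have [E1x E1K] := EinvP x E1_onto.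
have [E2y E2K] := EinvP y E2_onto.
rewrite -/E1inv in E1x E1K; rewrite -/E2inv in E2y E2K.
have coeff0P (D R : place F) : R <> D -> coeff R (<< D >> : divisor F) = 0.
  by move=> RD; rewrite coeff_place; case: eqP => // /esym.
have LD12Q f : LD12 f -> f \in vring Q.
  by apply: RRspace_vring; rewrite coeffD !coeff0P ?addr0 //; apply/nesym.
set h := E1inv x * E2inv y.
have hL : LD12 h by apply: RRspaceM.
(* P i differs from D1 and D2, so it is a pole of neither factor. *)
have -> : hadamard (T (I1 (E1inv x))) (T (I2 (E2inv y))) = T h.
  apply: functional_extensionality_dep => i.
  have [_ PD1 PD2] := hP i.
  by rewrite /hadamard /T /evals evalpM //; [apply: RRspace_vring E1x|
    apply: RRspace_vring E2y]; apply: coeff0P.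
have -> : Tinv (T h) = h by apply: (pinvKV (fun=> 0) T_inj); rewrite inE.
have hval : Lambda h = x * y.
  rewrite /Lambda evalpM ?E1K ?E2K //;
    [apply: RRspace_vring E1x|apply: RRspace_vring E2y];
    by apply/coeff0P/nesym.
have : exists a, [set a | Ms a /\ M (h - a)] a.
  move: hL; rewrite dec => -[a Ma [b Mb <-]]; exists a.
  by rewrite /= addrC addKr.
move/(xgetPex (0 : F)); rewrite -/(proj_along Ms M h).
set a := proj_along _ _ _ => -[_ Mha].
(* The component of h along M vanishes at Q. *)
have hE : evalp Q (h - a) = 0 by apply: M_ker.
rewrite -hval; apply/eqP; rewrite -subr_eq0 /Lambda -hE.
have aO : a \in vring Q.
  by rewrite -[a](subKr h) rpredB //; apply: LD12Q => //; apply: M_sub.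
by rewrite evalpB // LD12Q.
Qed.
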